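(* As $\omega(n)\to+\infty$, $$k(n-1)\leqslant \omega(n)^{\omega(n)(1+o(1))};$$ that is, there is a function $\varepsilon(s)\to0$ as $s\to\infty$ such that $k(n-1)\le \omega(n)^{\omega(n)(1+\varepsilon(\omega(n)))}$ for all $n\ge2$ with $\omega(n)\ge2$.
   Context: $\omega(n)$ is the number of distinct prime divisors of $n$. For $n\ge1$ let $t(n)$ be the rooted planar tree of $n$: $t(1)$ is the single-vertex tree; if $n=p_1^{a_1}\cdots p_s^{a_s}$ with primes $p_1<\dots<p_s$, $a_i\ge1$, then $t(n)$ is a root with $s$ ordered edges, the $i$-th leading to a copy of $t(a_i)$. Let $t^\#(n)$ be the corresponding nonplanar rooted tree (forgetting the order of children). For $n\ge0$, $k(n)=\max\{k\ge1: t^\#(n+1)=t^\#(n+2)=\cdots=t^\#(n+k)\}$. *)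

(* Defs.v *)
From HB Require Import structures.
From mathcomp Require Import all_boot.

Set Implicit Arguments.
Unset Strict Implicit.
Unset Printing Implicit Defensive.

Local Open Scope quotient_scope.

Definition omega (n : nat) : nat := size (primes n).

Inductive planar_tree : Type := Node of seq planar_tree.

Lemma planar_tree_seq_ind (P : planar_tree -> Prop) :
  (forall s, (forall i, i < size s -> P (nth (Node [::]) s i)) -> P (Node s)) ->
  forall t, P t.
Proof.
move=> IH; fix rec 1 => -[s]; apply: IH.
elim: s => [|x s IHs] i lt_i; first by discriminate lt_i.
by case: i lt_i => [|i] lt_i; [exact: (rec x) | exact: (IHs i lt_i)].
Qed.

Fixpoint planar_tree_encode (t : planar_tree) : GenTree.tree void :=
  let: Node s := t in GenTree.Node 0 [seq planar_tree_encode u | u <- s].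

Fixpoint planar_tree_decode (t : GenTree.tree void) : planar_tree :=
  match t with
  | GenTree.Leaf _ => Node [::]
  | GenTree.Node _ s => Node [seq planar_tree_decode u | u <- s]
  end.

Lemma planar_tree_encodeK : cancel planar_tree_encode planar_tree_decode.
Proof.
elim/planar_tree_seq_ind=> s IH /=; congr Node; rewrite -map_comp.
apply: (@eq_from_nth _ (Node [::])); rewrite size_map // => i lt_i.
by rewrite (nth_map (Node [::])) //= IH.
Qed.

HB.instance Definition _ := Countable.copy planar_tree (can_type planar_tree_encodeK).

(* [reorder t u]: [u] is obtained from [t] by reordering, at every vertex, the
   children of that vertex. *)
Fixpoint reorder (t u : planar_tree) : bool :=
  let: Node s := t in
  let: Node r := u in
  has (fun r' => all2 reorder s r') (permutations r).

Lemma reorderP s r :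
  reflect (exists2 r', perm_eq r' r & all2 reorder s r')
          (reorder (Node s) (Node r)).
Proof.
by apply: (iffP hasP) => -[r' r'P ?]; exists r' => //; move: r'P;
  rewrite mem_permutations.
Qed.

Lemma all2_nthP (T : Type) (x0 : T) (e : rel T) (s r : seq T) :
  reflect (size s = size r /\ forall i, i < size s -> e (nth x0 s i) (nth x0 r i))
          (all2 e s r).
Proof.
elim: s r => [|x s IHs] [|y r] /=; try by constructor; case.
  by constructor; split.
apply: (iffP andP) => [[exy /IHs [-> H]]|[[sz_sr] H]].
  by split=> // -[|i] //=; exact: H.
split; first exact: (H 0).
by apply/IHs; split=> // i lt_i; exact: (H i.+1).
Qed.

Lemma all2_perm (T : eqType) (e : rel T) (s r s' : seq T) :
  all2 e s r -> perm_eq s' s -> exists2 r', perm_eq r' r & all2 e s' r'.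
Proof.
case: s => [|x0 s0]; first by case: r => // _ /perm_nilP ->; exists [::].
move: (x0 :: s0) => {s0} s /(all2_nthP x0) [sz_sr H].
case/(perm_iotaP x0) => Is perm_Is ->.
exists [seq nth x0 r i | i <- Is].
  by apply/(perm_iotaP x0); exists Is; rewrite -?sz_sr.
apply/(all2_nthP x0); rewrite !size_map; split=> // i lt_i.
rewrite !(nth_map 0) //; apply: H.
by have := mem_nth 0 lt_i; rewrite (perm_mem perm_Is) mem_iota.
Qed.

Lemma reorder_refl : reflexive reorder.
Proof.
elim/planar_tree_seq_ind=> s IH; apply/reorderP; exists s => //.
by apply/(all2_nthP (Node [::])).
Qed.

Lemma reorder_imply_sym t u : reorder t u -> reorder u t.
Proof.
elim/planar_tree_seq_ind: t u => s IH [r] /reorderP [r' perm_r sr'].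
have r's : all2 reorder r' s.
  case/(all2_nthP (Node [::])): sr' => sz_sr H.
  apply/(all2_nthP (Node [::])); split=> // i; rewrite -sz_sr => lt_i.
  by apply: IH => //; exact: H.
have [|s' perm_s rs'] := all2_perm r's (s' := r); first by rewrite perm_sym.
by apply/reorderP; exists s'.
Qed.

Lemma reorder_sym : symmetric reorder.
Proof. by move=> t u; apply/idP/idP; exact: reorder_imply_sym. Qed.

Lemma reorder_trans : transitive reorder.
Proof.
move=> u t; elim/planar_tree_seq_ind: t u => s IH [r] [q].
case/reorderP=> r' perm_r sr' /reorderP [q' perm_q rq'].
have [q2 perm_q2 r'q2] := all2_perm rq' perm_r.
apply/reorderP; exists q2; first exact: perm_trans perm_q2 perm_q.
case/(all2_nthP (Node [::])): sr' => sz_sr H1.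
case/(all2_nthP (Node [::])): r'q2 => sz_rq H2.
apply/(all2_nthP (Node [::])); rewrite sz_sr sz_rq; split=> // i.
rewrite -sz_rq -sz_sr => lt_i; apply: (IH i lt_i (nth (Node [::]) r' i)).
  exact: H1.
by apply: H2; rewrite -sz_sr.
Qed.

Canonical reorder_equiv : equiv_rel planar_tree :=
  EquivRel reorder reorder_refl reorder_sym reorder_trans.

Definition nonplanar_tree : Type := {eq_quot reorder_equiv}.
HB.instance Definition _ := Choice.on nonplanar_tree.

Definition forget_order (t : planar_tree) : nonplanar_tree :=
  \pi_({eq_quot reorder_equiv}) t.

Lemma forget_orderP t u :
  reflect (forget_order t = forget_order u) (reorder t u).
Proof. exact: (eqmodP reorder_equiv t u). Qed.

(* The fuel bounds the height; [tE] is the recursion without fuel. *)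
Fixpoint t_fuel (fuel n : nat) : planar_tree :=
  if fuel is f.+1 then Node [seq t_fuel f (logn p n) | p <- primes n]
  else Node [::].

Definition t (n : nat) : planar_tree := t_fuel n n.

Lemma t_fuel_stable f g n : n <= f -> n <= g -> t_fuel f n = t_fuel g n.
Proof.
elim: f g n => [|f IHf] g n; first by rewrite leqn0 => /eqP ->; case: g.
case: g => [|g]; first by move=> _; rewrite leqn0 => /eqP ->.
move=> le_f le_g /=; congr Node; apply/eq_in_map => p p_n.
have n_gt0 : 0 < n by move: p_n; rewrite mem_primes => /and3P [].
have lt_n := ltn_logl p n_gt0.
by apply: IHf; rewrite -ltnS; exact: leq_trans lt_n _.
Qed.

(* [primes n] lists the prime divisors of [n] in increasing order.  At the
   irrelevant argument 0 the value is the single vertex. *)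
Lemma tE n : t n = Node [seq t (logn p n) | p <- primes n].
Proof.
case: n => [|n] //; rewrite /t /=; congr Node; apply/eq_in_map => p _.
by apply: t_fuel_stable => //; rewrite -ltnS ltn_logl.
Qed.

Definition t_sharp (n : nat) : nonplanar_tree := forget_order (t n).

Fixpoint vertices (u : planar_tree) : nat :=
  let: Node s := u in (sumn [seq vertices v | v <- s]).+1.

Lemma reorder_vertices u v : reorder u v -> vertices u = vertices v.
Proof.
elim/planar_tree_seq_ind: u v => s IH [r] /reorderP [r' perm_r sr'] /=.
congr S; have /perm_sumn <- := perm_map vertices perm_r; congr sumn.
case/(all2_nthP (Node [::])): sr' => sz_sr H.
apply: (@eq_from_nth _ 0); rewrite !size_map // => i lt_i.
by rewrite !(nth_map (Node [::])) -?sz_sr //; apply: IH => //; exact: H.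
Qed.

Lemma t_sharp_pow2 m : 0 < m -> t_sharp (2 ^ m) <> t_sharp m.
Proof.
move=> m_gt0 /forget_orderP /reorder_vertices.
rewrite tE primesX // primes_prime //= pfactorK // addn0.
by move/eqP; rewrite gtn_eqF.
Qed.

(* t^#(n+1) = ... = t^#(n+k) with k >= 1 *)
Definition constant_run (n k : nat) : bool :=
  (0 < k) && [forall i : 'I_k, t_sharp (n + i.+1) == t_sharp (n + 1)].

Lemma constant_run_exists n : exists k, constant_run n k.
Proof. by exists 1; apply/andP; split=> //; apply/forallP => i; rewrite ord1. Qed.

Lemma constant_run_bounded n k : constant_run n k -> k <= 2 ^ n.+1.
Proof.
case/andP=> _ /forallP run; rewrite leqNgt; apply/negP => lt_k.
have lt_i : 2 ^ n.+1 - n.+1 < k by exact: leq_ltn_trans (leq_subr _ _) lt_k.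
have /eqP := run (Ordinal lt_i).
by rewrite /= addnS -addSn subnKC ?addn1; [exact: t_sharp_pow2 | exact/ltnW/ltn_expl].
Qed.

Definition k (n : nat) : nat :=
  ex_maxn (constant_run_exists n) (@constant_run_bounded n).

(* Main.v *)
Require Import Defs.
From mathcomp Require Import all_boot all_order all_algebra.
From mathcomp Require Import all_classical all_reals all_analysis.
From mathcomp Require Import zify ring lra.
Import Order.TTheory GRing.Theory Num.Theory.
Import numFieldNormedType.Exports.

(* The tree of [m] determines [omega m], the degree of its root.  If [M] is a
   product of [s + 1] distinct primes, any [M] consecutive integers contain a
   multiple of [M], so a run of integers with [omega = s] is shorter than [M].
   Chebyshev's argument provides a small [M]: each prime power in the
   factorization of ['C(2n, n) >= 2^n] is at most [2n], so this coefficient has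
   more than [s] prime divisors, all at most [2n], as soon as [(2n)^s < 2^n].
   This holds for some [2n = O(s log s)], and then
   [M <= (2n)^(s + 1) = s^(s (1 + o(1)))]. *)

(** * Size and prime factorization of central binomial coefficients *)

Lemma exp2_le_central_bin n : 2 ^ n <= 'C(n.*2, n).
Proof.
elim: n => [|n IH] //.
rewrite doubleS expnS binS.
(* By symmetry, the two summands in Pascal's rule are equal; each is at least ['C(n.*2, n)]. *)
have -> : 'C(n.*2.+1, n.+1) = 'C(n.*2.+1, n).
  by rewrite -bin_sub; [congr binomial; lia | lia].
rewrite mul2n -addnn leq_add //; apply: (leq_trans IH);
  by case: n {IH} => // n; rewrite binS leq_addr.
Qed.

Lemma divn_double_le n d : 0 < d -> n.*2 %/ d <= (n %/ d).*2.+1.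
Proof.
move=> d_gt0; rewrite -ltnS ltn_divLR // -doubleS -doubleMl ltn_double.
by rewrite -ltn_divLR.
Qed.

(* By Legendre's formula the exponent is the sum over [i] of
   [2n / p^i - 2 (n / p^i)], whose terms are at most 1, and 0 once [p^i > 2n]. *)
Lemma central_bin_prime_power_le n p :
  0 < n -> prime p -> p ^ logn p 'C(n.*2, n) <= n.*2.
Proof.
move=> n_gt0 p_pr; have p_gt1 := prime_gt1 p_pr.
set e := logn _ _; set T := trunc_log p n.*2.
have n2_gt0 : 0 < n.*2 by rewrite double_gt0.
have le_pT : p ^ T <= n.*2 by apply: trunc_logP.
suff le_eT : e <= T by apply: leq_trans le_pT; rewrite leq_exp2l.
have le_T : T <= n.*2 by apply: leq_trans le_pT; apply/ltnW/ltn_expl.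
have div_sum m a b : 0 < a <= b -> (forall i, a <= i -> m < p ^ i) ->
    \sum_(1 <= i < b) m %/ p ^ i = \sum_(1 <= i < a) m %/ p ^ i.
  case/andP=> a_gt0 le_ab lt_m; rewrite (big_cat_nat a_gt0 le_ab) /=.
  rewrite [X in _ + X]big_nat_cond [X in _ + X]big1 ?addn0 // => i.
  by case/andP=> /andP[/lt_m lt_mi _] _; rewrite divn_small.
(* The Legendre sums for [n] and [n.*2] are cut at the same [T], so that they compare term by
   term. *)
have fact_sum m : m <= n.*2 -> logn p m`! = \sum_(1 <= i < T.+1) m %/ p ^ i.
  move=> le_m; rewrite logn_fact //.
  have <- : \sum_(1 <= i < n.*2.+1) m %/ p ^ i = \sum_(1 <= i < m.+1) m %/ p ^ i.
    apply: div_sum; rewrite ?ltnS // => i lt_mi.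
    exact: ltn_trans lt_mi (ltn_expl _ p_gt1).
  apply: div_sum; rewrite ?ltnS // => i lt_Ti.
  apply: leq_ltn_trans le_m (leq_trans (trunc_log_ltn _ p_gt1) _).
  by rewrite leq_exp2l.
have e_sum : e + (logn p n`!).*2 = logn p (n.*2)`!.
  have le_n : n <= n.*2 by rewrite -addnn leq_addr.
  have sub_n : n.*2 - n = n by rewrite -addnn addnK.
  rewrite -(bin_fact le_n) sub_n -addnn.
  by rewrite !lognM ?muln_gt0 ?fact_gt0 ?bin_gt0.
(* Adding to both sides avoids truncated subtraction; [T] is then written as a sum of ones. *)
rewrite -(leq_add2r (logn p n`!).*2) e_sum !fact_sum //; last lia.
have {2}-> : T = \sum_(1 <= i < T.+1) 1 by rewrite sum_nat_const_nat muln1 subn1.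
rewrite -[(\sum_(_ <= _ < _) _).*2]addnn -!big_split /= leq_sum // => i _; rewrite !addnn add1n.
by apply: divn_double_le; rewrite expn_gt0 ltnW.
Qed.

Lemma prod_le_expn_size (T : eqType) (s : seq T) (F : T -> nat) B :
  (forall x, x \in s -> F x <= B) -> \prod_(x <- s) F x <= B ^ size s.
Proof.
elim: s => [|x s IH] le_B; first by rewrite big_nil.
rewrite big_cons expnS leq_mul ?le_B ?mem_head // IH // => y y_s.
by rewrite le_B // inE y_s orbT.
Qed.

Lemma prod_primes n : 0 < n -> n = \prod_(p <- primes n) p ^ logn p n.
Proof.
by move=> n_gt0; rewrite {1}(prod_prime_decomp n_gt0) prime_decompE big_map.
Qed.

(* [M] is the product of [s.+1] prime divisors of ['C(n.*2, n)], which has more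
   than [s] of them because it is at least [2 ^ n]. *)
Lemma ex_small_multiple_many_primes s n :
  0 < n -> n.*2 ^ s < 2 ^ n ->
  exists2 M, 0 < M <= n.*2 ^ s.+1 &
    forall m, 0 < m -> M %| m -> s < omega m.
Proof.
move=> n_gt0 lt_pow; set C := 'C(n.*2, n).
have C_gt0 : 0 < C by rewrite bin_gt0 -addnn leq_addr.
have le_2n p : p \in primes C -> p ^ logn p C <= n.*2.
  rewrite mem_primes => /and3P[p_pr _ _].
  exact: central_bin_prime_power_le.
have lt_s : s < omega C.
  (* Exponents are compared in [n.*2 ^ s < 2 ^ n <= C <= n.*2 ^ omega C]. *)
  rewrite -(@ltn_exp2l n.*2) -?addnn ?(leq_add n_gt0) // addnn.
  apply: leq_trans lt_pow (leq_trans (exp2_le_central_bin n) _).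
  by rewrite -/C {1}(prod_primes C C_gt0) prod_le_expn_size.
pose ps := take s.+1 (primes C).
have ps_C p : p \in ps -> p \in primes C by apply: mem_take.
have sz_ps : size ps = s.+1 by rewrite size_takel.
exists (\prod_(p <- ps) p).
  rewrite -sz_ps prod_le_expn_size ?andbT.
    rewrite big_seq prodn_cond_gt0 // => p /ps_C.
    by rewrite mem_primes => /and3P[/prime_gt0].
  move=> p /ps_C p_C; apply: leq_trans (le_2n p p_C).
  have p_gt1 : 1 < p by move: p_C; rewrite mem_primes => /and3P[/prime_gt1].
  by rewrite -{1}(expn1 p) leq_exp2l // logn_gt0.
move=> m m_gt0 dvd_m; rewrite -sz_ps uniq_leq_size //.
  by rewrite take_uniq // primes_uniq.
move=> p p_ps; have := ps_C p p_ps; rewrite !mem_primes => /and3P[-> _ _].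
rewrite m_gt0; apply: dvdn_trans dvd_m.
by rewrite (big_rem p p_ps) /= dvdn_mulr.
Qed.

(** * Runs of integers with the same tree *)

Lemma t_sharp_omega m n : t_sharp m = t_sharp n -> omega m = omega n.
Proof.
move=> /forget_orderP; rewrite !tE => /reorderP[r /perm_size sz_r].
case/(all2_nthP (Node [::])); rewrite sz_r !size_map => sz_eq _.
by rewrite /omega /primes !size_map.
Qed.

Lemma ex_dvdn_ge n M : 0 < M -> exists2 i, i < M & M %| n + i.
Proof.
move=> M_gt0; exists ((M - n %% M) %% M); first by rewrite ltn_mod.
rewrite /dvdn modnDmr -modnDml subnKC ?modnn //.
exact/ltnW/ltn_pmod.
Qed.

Lemma k_lt s n M : 0 < n -> omega n = s -> 0 < M ->
  (forall m, 0 < m -> M %| m -> s < omega m) -> k (n - 1) < M.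
Proof.
move=> n_gt0 om_n M_gt0 big_om; rewrite ltnNge; apply/negP => le_k.
have [i lt_iM dvd_i] := ex_dvdn_ge n _ M_gt0.
have := big_om _ (ltn_addr i n_gt0) dvd_i; apply/negP; rewrite -leqNgt -om_n.
move: le_k; rewrite /k; case: ex_maxnP => j /andP[_ /forallP run] _ le_Mj.
(* The run measured by [k (n - 1)] starts at [n] itself, so its entry of index [i] is the multiple
   [n + i]. *)
have /eqP/t_sharp_omega := run (Ordinal (leq_trans lt_iM le_Mj)).
by rewrite /= addn1 addnS -addSn subn1 prednK // => ->.
Qed.

(* With [L := log_scale s], the choice [n := 4 * s * L] gives
   [n.*2 ^ s < 2 ^ n], and [8 * s * L] is [s ^ (1 + o(1))]. *)
Definition log_scale (s : nat) : nat := (trunc_log 2 s).+1.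

Lemma k_le n : 2 <= omega n ->
  k (n - 1) <= (8 * omega n * log_scale (omega n)) ^ (omega n).+1.
Proof.
move=> om2; set s := omega n in om2 *; set L := log_scale s.
have n_gt0 : 0 < n by case: n @s om2 @L.
have L2 : 1 < L by rewrite ltnS trunc_log_gt0.
have lt_s : s < 2 ^ L by apply: trunc_log_ltn.
have -> : 8 * s * L = (4 * s * L).*2 by lia.
have [||M /andP[M_gt0 le_M] big_om] := @ex_small_multiple_many_primes s (4 * s * L).
- lia.
(* Without the exponent [s], this is [8 * s * L < 2 ^ (4 * L)]: both [s] and [L] are below [2 ^ L],
   and [3 + 2 * L <= 4 * L] as [L >= 2]. *)
- have -> : 2 ^ (4 * s * L) = (2 ^ (4 * L)) ^ s by rewrite -expnM; congr expn; lia.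
  rewrite ltn_exp2r; last by lia.
  apply: (@leq_trans (2 ^ (3 + L + L))); last by rewrite leq_exp2l //; lia.
  rewrite !expnD; have := ltn_expl L (ltnSn 1); nia.
by apply: leq_trans le_M; apply: ltnW; apply: (@k_lt s) big_om.
Qed.

(** * Asymptotics of the exponent *)

Local Open Scope classical_set_scope.
Local Open Scope ring_scope.

Lemma ln_le_subr1 (R : realType) (x : R) : 0 < x -> ln x <= x - 1.
Proof.
by move=> x_gt0; have := @le_ln1Dx R (x - 1); rewrite [1 + _]addrC subrK; apply; lra.
Qed.

(** With [q] the square root of [L], [ln 8 + 2 * ln q <= 7 + 2 * (q - 1) <= 9 * q]. *)
Lemma ln_mul8_le_sqrt (R : realType) (L : nat) : (0 < L)%N ->
  ln (8 * L%:R : R) <= 9 * Num.sqrt L%:R.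
Proof.
move=> L_gt0; have L_ge1 : 1 <= L%:R :> R by rewrite ler1n.
set q := Num.sqrt _.
have q_ge1 : 1 <= q by rewrite -sqrtr1 ler_wsqrtr.
have -> : L%:R = q ^+ 2 by rewrite sqr_sqrtr //; lra.
rewrite lnM ?posrE ?exprn_gt0 //; last by lra.
rewrite lnXn; last by lra.
have := @ln_le_subr1 R 8; have := @ln_le_subr1 R q.
move=> /(_ (lt_le_trans ltr01 q_ge1)) ? /(_ ltac:(lra)) ?; lra.
Qed.

(** From [2 ^ T <= s] and [ln 2 >= 1/2] follows [T <= 2 * ln s], and [T + 1 <= 2 * T]. *)
Lemma log_scale_le_ln (R : realType) (s : nat) : (2 <= s)%N ->
  (log_scale s)%:R <= 4 * ln s%:R :> R.
Proof.
move=> s2; rewrite /log_scale; set T := trunc_log 2 s.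
have T_ge1 : 1 <= T%:R :> R by rewrite ler1n trunc_log_gt0.
have ln2 : 2^-1 <= ln (2 : R).
  have := @ln_le_subr1 R 2^-1; rewrite lnV ?posrE //; lra.
have : ln ((2 ^ T)%N%:R : R) <= ln (s%:R).
  have le_s : (2 ^ T <= s)%N by apply: trunc_logP => //; apply: ltnW.
  by rewrite ler_ln ?posrE ?ltr0n ?ler_nat ?expn_gt0 //; apply: ltnW.
rewrite natrX lnXn // => le_ln.
rewrite -natr1.
have : 2^-1 * T%:R <= ln 2 * T%:R :> R by rewrite ler_wpM2r.
by rewrite mulr_natr; lra.
Qed.

(** The solution of [s * (1 + eps) * ln s = (s + 1) * ln (8 * s * L)] with [L = log_scale s], which
    makes the bound of [k_le] an exact power of [s]. *)
Definition eps (R : realType) (s : nat) : R :=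
  s.+1%:R * ln ((8 * s * log_scale s)%N%:R : R) / (s%:R * ln s%:R) - 1.

Lemma powR_eps (R : realType) (s : nat) : (2 <= s)%N ->
  s%:R `^ (s%:R * (1 + eps R s)) = ((8 * s * log_scale s) ^ s.+1)%N%:R :> R.
Proof.
move=> s2; have s_gt1 : 1 < s%:R :> R by rewrite ltr1n.
have ln_gt := ln_gt0 s_gt1.
have base_gt0 : 0 < (8 * s * log_scale s)%N%:R :> R.
  by rewrite ltr0n !muln_gt0 /= andbT ltnW.
rewrite /powR gt_eqF; last by lra.
rewrite natrX -[in RHS](lnK base_gt0) -expRM_natl; congr expR.
rewrite /eps [1 + _]addrC subrK; field; lra.
Qed.

(** Since [harmonic m] is [1 / (m + 1)], the upper bound is [73 / q] with [q] the square root of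
    [log_scale s]. *)
Lemma eps_bounds (R : realType) (s : nat) : (2 <= s)%N ->
  0 <= eps R s <= 73 * Num.sqrt (harmonic (trunc_log 2 s)).
Proof.
move=> s2; have s_gt1 : 1 < s%:R :> R by rewrite ltr1n.
have ln_gt := ln_gt0 s_gt1.
have L_ge1 : 1 <= (log_scale s)%:R :> R by rewrite ler1n.
have L_le : (log_scale s)%:R <= s%:R :> R.
  have s_gt0 : (0 < s)%N by apply: ltnW.
  rewrite ler_nat; apply: leq_trans (trunc_logP (ltnSn 1) s_gt0).
  exact: ltn_expl.
have epsE : eps R s = s%:R^-1 +
    (1 + s%:R^-1) * (ln (8 * (log_scale s)%:R) / ln s%:R).
  rewrite /eps mulnAC natrM natrM lnM ?posrE; try lra.
  rewrite -natr1; field; lra.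
have ln_ge : 0 <= ln (8 * (log_scale s)%:R : R) by apply: ln_ge0; lra.
have sV_ge0 : 0 <= s%:R^-1 :> R by rewrite invr_ge0; lra.
apply/andP; split.
  by rewrite epsE addr_ge0 // mulr_ge0 ?addr_ge0 // divr_ge0 // ltW.
rewrite /= sqrtrV //.
set q := Num.sqrt _.
have q_ge1 : 1 <= q by rewrite -sqrtr1 ler_wsqrtr.
have qL : (log_scale s)%:R = q ^+ 2 by rewrite sqr_sqrtr //; lra.
have sV_le : s%:R^-1 <= q^-1.
  rewrite lef_pV2 ?posrE; try lra.
  by apply: le_trans L_le; rewrite qL; nra.
have qV_le1 : q^-1 <= 1 by rewrite invf_le1; lra.
(* The numerator is at most [9 * q], and [q ^ 2 <= 4 * ln s]. *)
have quot_le : ln (8 * (log_scale s)%:R) / ln s%:R <= 36 * q^-1.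
  rewrite ler_pdivrMr //.
  apply: le_trans (@ln_mul8_le_sqrt R (log_scale s) isT) _; rewrite -/q.
  have := @log_scale_le_ln R s s2; rewrite qL => le_q.
  have -> : 36 * q^-1 * ln s%:R = 9 * (q^-1 * (4 * ln s%:R)) by ring.
  rewrite ler_pM2l // mulrC ler_pdivlMr; last by lra.
  by rewrite -expr2.
rewrite epsE; move: quot_le; set u := ln _ / _ => quot_le.
have u_ge0 : 0 <= u by rewrite divr_ge0 // ltW.
(* Hence [(1 + 1/s) * u <= 2 * u], and the constant is [73 = 1 + 2 * 36]. *)
have : 0 <= (1 - s%:R^-1) * u by rewrite mulr_ge0 //; lra.
lra.
Qed.

Lemma trunc_log_cvg : trunc_log 2 s @[s --> \oo] --> \oo.
Proof.
apply/cvgnyPge => A; exists (2 ^ A)%N => //= s le_s.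
exact: trunc_log_max.
Qed.

Lemma eps_cvg0 (R : realType) : eps R s @[s --> \oo] --> (0 : R).
Proof.
have bound0 : 73 * Num.sqrt (harmonic (trunc_log 2 s)) @[s --> \oo] --> (0 : R).
  rewrite -[X in _ --> X](mulr0 73); apply: cvgM; first exact: cvg_cst.
  rewrite -[X in _ --> X](sqrtr0 R).
  apply: (@cvg_comp _ _ _ (fun s => harmonic (trunc_log 2 s)) Num.sqrt _ (nbhs (0 : R))).
    exact: cvg_comp trunc_log_cvg cvg_harmonic.
  exact: sqrt_continuous.
apply: squeeze_cvgr bound0; last exact: cvg_cst.
by exists 2%N => //= s; apply: eps_bounds.
Qed.

Theorem theorem9 (R : realType) :
  exists eps : nat -> R,
    eps s @[s --> \oo] --> (0 : R) /\
    forall n : nat, (2 <= n)%N -> (2 <= omega n)%N ->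
      (k (n - 1))%:R <= (omega n)%:R `^ ((omega n)%:R * (1 + eps (omega n))) :> R.
Proof.
exists (eps R); split; first exact: eps_cvg0.
by move=> n _ om2; rewrite powR_eps // ler_nat k_le.
Qed.
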